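(* Fix a weight $\lambda\in\Lambda$ and an integer $k$. Then the family of operators on $\tilde K_T(G/B)$ $$R_\alpha=X^{k\alpha}+X^{(\lambda,\alpha^\vee)\alpha}B_\alpha=X^\lambda(X^{k\alpha}+B_\alpha)X^{-\lambda},\qquad \alpha\in\Phi,$$ is an $R$-matrix, i.e. satisfies $R_{-\alpha}=R_\alpha^{-1}$ and the Yang–Baxter equation.
   Context: $G$ connected, simply connected, simple complex Lie group, Borel $B\supset T$, irreducible root system $\Phi$, positive roots $\Phi^+$, coroots $\alpha^\vee=2\alpha/(\alpha,\alpha)$, Weyl group $W$ with length $\ell$, weight lattice $\Lambda$, $\rho$ the sum of fundamental weights, $\theta^\vee$ the highest coroot, $h=(\rho,\theta^\vee)+1$ the Coxeter number. $K_T(G/B)$ is a free $\mathbb Z[X]$-module ($\mathbb Z[X]$ = group algebra of $\Lambda$ with basis $x^\mu$) with basis $[\mathcal O_w]:=*[\mathcal O_{X_w}]$, $w\in W$ ($X_w=\overline{BwB/B}$, $*$ the dualizing involution). Let $\mathbb Z[\tilde X]$ be the group algebra of $\Lambda/h=\{\lambda/h\}$ (basis $x^{\lambda/h}$) and $\tilde K_T(G/B)=K_T(G/B)\otimes_{\mathbb Z[X]}\mathbb Z[\tilde X]$, with $\mathbb Z[\tilde X]$-basis $[\mathcal O_w]$. For $\alpha\in\Phi^+$ the Bruhat operator $B_\alpha$ is the $\mathbb Z[\tilde X]$-linear map $[\mathcal O_w]\mapsto[\mathcal O_{ws_\alpha}]$ if $\ell(ws_\alpha)=\ell(w)-1$,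 $\mapsto0$ otherwise; $B_\alpha:=-B_{-\alpha}$ for $\alpha\in\Phi^-$. For $\lambda\in\Lambda$, $X^\lambda$ is the $\mathbb Z[\tilde X]$-linear map $[\mathcal O_w]\mapsto x^{w(\lambda)/h}[\mathcal O_w]$. $R$-matrix: a collection of invertible operators $\{R_\alpha:\alpha\in\Phi\}$ with $R_{-\alpha}=R_\alpha^{-1}$ and, for every $\alpha,\beta\in\Phi$ with $(\alpha,\beta)\le0$, $R_\alpha R_{s_\alpha(\beta)}R_{s_\alpha s_\beta(\alpha)}\cdots R_{s_\beta(\alpha)}R_\beta=R_\beta R_{s_\beta(\alpha)}\cdots R_{s_\alpha s_\beta(\alpha)}R_{s_\alpha(\beta)}R_\alpha$, the products running over the $m$ roots of the rank-2 subsystem generated by $\alpha,\beta$ that are nonnegative combinations of $\alpha,\beta$ in the order $\alpha,s_\alpha(\beta),\dots,s_\beta(\alpha),\beta$ ($2m$ the order of $\langle s_\alpha,s_\beta\rangle$). *)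

(* Defs.v *)
From HB Require Import structures.
From mathcomp Require Import all_boot all_order all_algebra.
From mathcomp Require Import boolp reals.
Set Implicit Arguments.
Unset Strict Implicit.
Unset Printing Implicit Defensive.
Import Order.TTheory GRing.Theory Num.Theory.
Local Open Scope ring_scope.

Section RootData.
Variables (R : realType) (n : nat).
(* The Euclidean space t*_R is modelled as column vectors R^n with the
   standard inner product; Weyl group elements are n x n matrices acting
   by left multiplication. *)
Local Notation V := 'cV[R]_n.
Local Notation M := 'M[R]_n.

Definition dot (x y : V) : R := (x^T *m y) 0 0.
Definition coroot (a : V) : V := (2 / dot a a) *: a.
Definition refl_mx (a : V) : M := 1%:M - a *m (coroot a)^T.
Definition act (w : M) (x : V) : V := w *m x.

Definition root_system (Phi : seq V) : Prop :=
  [/\ uniq Phi, (0 : V) \notin Phi,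
      forall a (c : R), a \in Phi -> c *: a \in Phi -> c = 1 \/ c = -1,
      forall a b, a \in Phi -> b \in Phi -> act (refl_mx a) b \in Phi
    & forall a b, a \in Phi -> b \in Phi -> dot b (coroot a) \is a Num.int].

Definition irreducible_rs (Phi : seq V) : Prop :=
  forall P : pred V, (exists2 a, a \in Phi & P a) ->
    (exists2 b, b \in Phi & ~~ P b) ->
    exists a b, [/\ a \in Phi, b \in Phi, P a, ~~ P b & dot a b != 0].

Definition is_base (Phi : seq V) (delta : 'I_n -> V) : Prop :=
  [/\ forall i, delta i \in Phi,
      row_free (\matrix_(i < n) (delta i)^T)
    & forall a, a \in Phi -> exists c : 'I_n -> int,
        a = \sum_i (c i)%:~R *: delta i /\
        ((forall i, 0 <= c i) \/ (forall i, c i <= 0))].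

Definition positive (Phi : seq V) (delta : 'I_n -> V) (a : V) : Prop :=
  a \in Phi /\ exists c : 'I_n -> int,
    (forall i, 0 <= c i) /\ a = \sum_i (c i)%:~R *: delta i.

Definition fund_weights (delta omega : 'I_n -> V) : Prop :=
  forall i j, dot (omega i) (coroot (delta j)) = (i == j)%:R.

Definition rho (omega : 'I_n -> V) : V := \sum_i omega i.

Definition highest_coroot (Phi : seq V) (delta : 'I_n -> V) (thv : V) : Prop :=
  (exists2 t, t \in Phi & thv = coroot t) /\
  forall b, b \in Phi -> exists c : 'I_n -> nat,
    thv - coroot b = \sum_i (c i)%:R *: coroot (delta i).

Definition coxeter (omega : 'I_n -> V) (thv : V) : R := dot (rho omega) thv + 1.

Definition weight (Phi : seq V) (lam : V) : Prop :=
  forall a, a \in Phi -> dot lam (coroot a) \is a Num.int.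

Definition in_W (Phi : seq V) (w : M) : Prop :=
  exists s : seq V, all (mem Phi) s /\ w = \prod_(a <- s) refl_mx a.

Definition length_is (delta : 'I_n -> V) (w : M) (l : nat) : Prop :=
  (exists s : seq 'I_n, size s = l /\ w = \prod_(i <- s) refl_mx (delta i)) /\
  (forall s : seq 'I_n, w = \prod_(i <- s) refl_mx (delta i) -> (l <= size s)%N).

(* Elements of tilde K_T(G/B) are encoded by their coefficients:
   f w nu = coefficient of x^nu [O_w]  (nu ranging over Lambda/h).
   An element is a function with finite support contained in W x Lambda/h. *)
Definition elt := M -> V -> int.
Definition op := elt -> elt.

Definition in_Kt (Phi : seq V) (h : R) (f : elt) : Prop :=
  (forall w nu, f w nu != 0 -> in_W Phi w /\ weight Phi (h *: nu)) /\
  (forall w, exists s : seq V, forall nu, f w nu != 0 -> nu \in s).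

(* X^mu : [O_w] |-> x^{w(mu)/h} [O_w]  (Z[tilde X]-linear) *)
Definition Xop (h : R) (mu : V) : op :=
  fun f w nu => f w (nu - h^-1 *: act w mu).

(* B_a for a positive: [O_w] |-> [O_{w s_a}] if l(w s_a) = l(w) - 1, else 0 *)
Definition Bpos (delta : 'I_n -> V) (a : V) : op :=
  fun f v nu =>
    if `[< exists l, length_is delta v l /\
                     length_is delta (v *m refl_mx a) l.+1 >]
    then f (v *m refl_mx a) nu else 0.

Definition Bop (Phi : seq V) (delta : 'I_n -> V) (a : V) : op :=
  if `[< positive Phi delta a >] then Bpos delta a
  else if `[< positive Phi delta (- a) >] then
    (fun f v nu => - Bpos delta (- a) f v nu)
  else (fun _ _ _ => 0).

Definition addop (A B : op) : op := fun f w nu => A f w nu + B f w nu.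

Definition Rmat (Phi : seq V) (delta : 'I_n -> V) (h : R) (lam : V) (k : int)
  (a : V) : op :=
  addop (Xop h (k%:~R *: a))
        (fun f => Xop h (dot lam (coroot a) *: a) (Bop Phi delta a f)).

Definition opseq (l : seq op) : op := fun f => foldr (fun A g => A g) f l.

Definition alt_prod (a b : V) (j : nat) : M :=
  \prod_(i < j) (if odd i then refl_mx b else refl_mx a).

(* the j-th root (j = 0..m-1) in the list a, s_a(b), s_a s_b(a), ..., b *)
Definition gamma (a b : V) (j : nat) : V :=
  act (alt_prod a b j) (if odd j then b else a).

Definition order_is (g : M) (m : nat) : Prop :=
  [/\ (0 < m)%N, g ^+ m = 1 & forall j, (0 < j < m)%N -> g ^+ j != 1].

Definition is_R_matrix (Phi : seq V) (h : R) (Rop : V -> op) : Prop :=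
  (forall a, a \in Phi -> forall f, in_Kt Phi h f ->
     Rop (- a) (Rop a f) = f /\ Rop a (Rop (- a) f) = f) /\
  (forall a b, a \in Phi -> b \in Phi -> dot a b <= 0 ->
   forall m, order_is (refl_mx a * refl_mx b) m ->
   forall f, in_Kt Phi h f ->
     opseq [seq Rop (gamma a b j) | j <- iota 0 m] f =
     opseq (rev [seq Rop (gamma a b j) | j <- iota 0 m]) f).

End RootData.

(* Main.v *)
(* Conjugation by X^lambda reduces everything to R_a = X^{ka} + B_a.  A product
   of such operators, evaluated at v, is a signed sum over chains
   v -> v s_{g_1} -> v s_{g_1} s_{g_2} -> ... whose steps are covers.  By strong
   exchange, l(v s_g) > l(v) exactly when g and v g have the same sign; so a
   chain of r length-increasing steps consists of covers if and only if its end
   point has length l(v) + r, a condition which depends only on the end point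
   and r.  Both sides of the Yang-Baxter equation then become the same sums
   over the length-increasing chains in the dihedral group <s_a, s_b>, and the
   two families of chains agree, with signs and X-exponents, already before the
   length condition is imposed.  What is increasing depends only on the signs of
   the roots g and v g in the plane of a and b, so this is a finite
   verification for A1 x A1, A2, B2 and G2; letting the signs of the g vary
   covers pairs a, b that are not both positive. *)
Require Import Defs.
From HB Require Import structures.
From mathcomp Require Import all_boot all_order all_algebra.
From mathcomp Require Import boolp reals.
From mathcomp Require Import ring lra zify.
Import Order.TTheory GRing.Theory Num.Theory.
Local Open Scope ring_scope.

Set Implicit Arguments.
Unset Strict Implicit.
Unset Printing Implicit Defensive.

(** * Inner product, reflections and orthogonal matrices *)

Section Euclid.
Context {R : realType} {n : nat}.
Implicit Types (x y z a b : 'cV[R]_n) (g : 'M[R]_n).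

Lemma dotE x y : dot x y = \sum_i x i 0 * y i 0.
Proof. by rewrite /dot mxE; apply: eq_bigr => i _; rewrite mxE. Qed.

Lemma dotC x y : dot x y = dot y x.
Proof. by rewrite !dotE; apply: eq_bigr => i _; rewrite mulrC. Qed.

Lemma dotDr x y z : dot x (y + z) = dot x y + dot x z.
Proof. by rewrite /dot mulmxDr mxE. Qed.

Lemma dotZr c x y : dot x (c *: y) = c * dot x y.
Proof. by rewrite /dot -scalemxAr mxE. Qed.

Lemma dotDl x y z : dot (x + y) z = dot x z + dot y z.
Proof. by rewrite dotC dotDr !(dotC z). Qed.

Lemma dotZl c x y : dot (c *: x) y = c * dot x y.
Proof. by rewrite dotC dotZr dotC. Qed.

Lemma dotNr x y : dot x (- y) = - dot x y.
Proof. by rewrite -scaleN1r dotZr mulN1r. Qed.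

Lemma dotNl x y : dot (- x) y = - dot x y.
Proof. by rewrite dotC dotNr dotC. Qed.

Lemma dot0r x : dot x 0 = 0.
Proof. by rewrite -(scale0r 0) dotZr mul0r. Qed.

Lemma dot_sumr (I : Type) (r : seq I) (F : I -> 'cV[R]_n) x :
  dot x (\sum_(i <- r) F i) = \sum_(i <- r) dot x (F i).
Proof. by elim/big_rec2: _ => [|i y u _ <-]; rewrite ?dot0r ?dotDr. Qed.

Lemma dot_suml (I : Type) (r : seq I) (F : I -> 'cV[R]_n) x :
  dot (\sum_(i <- r) F i) x = \sum_(i <- r) dot (F i) x.
Proof. by rewrite dotC dot_sumr; apply: eq_bigr => i _; rewrite dotC. Qed.

Lemma dotxx_ge0 x : 0 <= dot x x.
Proof. by rewrite dotE; apply: sumr_ge0 => i _; rewrite -expr2 sqr_ge0. Qed.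

Lemma dotxx_eq0 x : dot x x = 0 -> x = 0.
Proof.
rewrite dotE => /eqP; rewrite psumr_eq0; last by move=> i _; rewrite -expr2 sqr_ge0.
move/allP => x0; apply/matrixP => i j; rewrite ord1 mxE.
by have := x0 i (mem_index_enum _); rewrite /= mulf_eq0 orbb => /eqP.
Qed.

Lemma dotxx_gt0 x : x != 0 -> 0 < dot x x.
Proof.
move=> x0; rewrite lt_def dotxx_ge0 andbT.
by apply: contraNneq x0 => /dotxx_eq0->.
Qed.

Lemma mul_rank1 x y z : x *m y^T *m z = dot z y *: x.
Proof.
by rewrite -mulmxA [y^T *m z]mx11_scalar mul_mx_scalar (dotC z).
Qed.

Lemma act_refl a x : refl_mx a *m x = x - dot x (coroot a) *: a.
Proof. by rewrite /refl_mx mulmxBl mul1mx mul_rank1. Qed.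

Lemma corootN a : coroot (- a) = - coroot a.
Proof. by rewrite /coroot dotNl dotNr opprK scalerN. Qed.

Lemma reflN a : refl_mx (- a) = refl_mx a.
Proof. by rewrite /refl_mx corootN linearN /= mulmxN mulNmx opprK. Qed.

Lemma dot_coroot a : a != 0 -> dot a (coroot a) = 2.
Proof. by move=> /dotxx_gt0/lt0r_neq0 a0; rewrite dotZr divfK. Qed.

Lemma refl_self a : a != 0 -> refl_mx a *m a = - a.
Proof.
by move=> a0; rewrite act_refl dot_coroot // scaler_nat mulr2n opprD addrA subrr sub0r.
Qed.

Lemma reflK a : a != 0 -> refl_mx a *m refl_mx a = 1%:M.
Proof.
move=> a0; rewrite {2}/refl_mx mulmxBr mulmx1 mulmxA refl_self // mulNmx opprK.
by rewrite /refl_mx subrK.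
Qed.

Definition orth g := g^T *m g = 1%:M.

Lemma orth1 : orth 1%:M.
Proof. by rewrite /orth trmx1 mulmx1. Qed.

Lemma orthM g1 g2 : orth g1 -> orth g2 -> orth (g1 *m g2).
Proof.
by rewrite /orth trmx_mul => o1 o2; rewrite -mulmxA (mulmxA _ g1) o1 mul1mx.
Qed.

Lemma orth_refl a : a != 0 -> orth (refl_mx a).
Proof.
move=> a0; rewrite /orth; suff -> : (refl_mx a)^T = refl_mx a by exact: reflK.
rewrite /refl_mx linearB /= trmx1 trmx_mul trmxK /coroot.
by rewrite linearZ /= -scalemxAl -scalemxAr.
Qed.

Lemma orth_dot {g} x y : orth g -> dot (g *m x) (g *m y) = dot x y.
Proof. by rewrite /dot trmx_mul -mulmxA (mulmxA _ g) => ->; rewrite mul1mx. Qed.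

Lemma orth_coroot g x : orth g -> coroot (g *m x) = g *m coroot x.
Proof. by move=> og; rewrite /coroot orth_dot // -scalemxAr. Qed.

Lemma refl_act g x : orth g -> refl_mx (g *m x) *m g = g *m refl_mx x.
Proof.
move=> og; rewrite /refl_mx orth_coroot // mulmxBl mulmxBr mul1mx mulmx1.
by rewrite trmx_mul -!mulmxA og mulmx1.
Qed.

End Euclid.

(** * Integer model of a rank-two root system and its finite verification *)

Notation icoord := (int * int)%type.
Notation rank2mx := (int * int * (int * int))%type.

Section RankTwo.
(* [c] and [d] are minus the Cartan integers (b, a^v) and (a, b^v).  The
   quadruple [K] stands for the matrix
   1 + k11 a (a^v)^T + k12 a (b^v)^T + k21 b (a^v)^T + k22 b (b^v)^T,
   [dstep] is right multiplication by s_a or s_b, and a pair (x1, x2) is the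
   vector x1 a + x2 b. *)
Variables c d : int.

Definition dstep (K : rank2mx) (s : bool) : rank2mx :=
  let: (k11, k12, (k21, k22)) := K in
  if s then (k11, c * k11 - k12, (k21, c * k21 - k22 - 1))
  else (d * k12 - k11 - 1, k12, (d * k22 - k21, k22)).

Definition dact (K : rank2mx) (x : icoord) : icoord :=
  let: (k11, k12, (k21, k22)) := K in
  let y1 := 2 * x.1 - c * x.2 in let y2 := 2 * x.2 - d * x.1 in
  (x.1 + k11 * y1 + k12 * y2, x.2 + k21 * y1 + k22 * y2).

Definition unit2 : rank2mx := (0, 0, (0, 0)).

Definition altw (j : nat) : seq bool := mkseq odd j.
(** A word for the reflection in [groot j]: the conjugate by [altw j] of the generator at which that
    root starts. *)
Definition reflw (j : nat) : seq bool := altw j ++ odd j :: rev (altw j).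
Definition groot (j : nat) : icoord :=
  dact (foldl dstep unit2 (altw j)) (if odd j then (0, 1) else (1, 0)).

Variable m : nat.

Definition groots : seq icoord := [seq groot j | j <- iota 0 m].

Definition isroot (x : icoord) := (x \in groots) || ((- x.1, - x.2) \in groots).

(* [sg] lists the signs of the roots in [groots]; the value is meaningful only
   when [isroot x]. *)
Definition rpos (sg : seq bool) (x : icoord) : bool :=
  if x \in groots then nth false sg (index x groots)
  else ~~ nth false sg (index (- x.1, - x.2) groots).

(* End point of a chain, number of its steps, and exponent of X divided by k. *)
Definition ending := (rank2mx * nat * icoord)%type.

(* The signed length-increasing chains starting at [K], where [sg] and [ta] are
   the signs of the roots v g and g respectively. *)
Fixpoint paths (sg ta : seq bool) (js : seq nat) (K : rank2mx) :
    seq (bool * ending) :=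
  if js is j :: js' then
    let x := dact K (groot j) in
    [seq (p.1, (p.2.1, (x.1 + p.2.2.1, x.2 + p.2.2.2))) | p <- paths sg ta js' K]
    ++ (if rpos sg x == nth false ta j then
          [seq (p.1 (+) ~~ nth false ta j, (p.2.1.1, p.2.1.2.+1, p.2.2))
             | p <- paths sg ta js' (foldl dstep K (reflw j))]
        else [::])
  else [:: (false, (K, 0%N, (0, 0)))].

(** Certifies that [rpos] is only asked about roots. Both branches are explored whatever the signs,
    so one check serves all sign lists. *)
Fixpoint inroots (js : seq nat) (K : rank2mx) : bool :=
  if js is j :: js' then
    [&& isroot (dact K (groot j)), inroots js' K
      & inroots js' (foldl dstep K (reflw j))]
  else true.

Definition mult (k : ending) (L : seq (bool * ending)) : int :=
  foldr (fun p z => if p.2 == k then (if p.1 then z - 1 else z + 1) else z) 0 L.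

(** Equality as signed multisets; endings occurring in neither list have multiplicity 0 on both
    sides. *)
Definition same (L L' : seq (bool * ending)) : bool :=
  all (fun p => mult p.2 L == mult p.2 L') (L ++ L').

(* A linear functional changes sign at most once along [groots]. *)
Definition patterns : seq (seq bool) :=
  [seq nseq i b ++ nseq (m - i) (~~ b) | i <- iota 0 m, b <- [:: true; false]].

(** The lists [ta] and [sg] vary independently, since the base point v may place the plane of a and
    b in any position relative to the positive roots. *)
Definition YB_check : bool :=
  [&& inroots (iota 0 m) unit2, inroots (rev (iota 0 m)) unit2 &
    all (fun ta => all (fun sg =>
      same (paths sg ta (iota 0 m) unit2) (paths sg ta (rev (iota 0 m)) unit2))
      patterns) patterns].

(** [K j] encodes the j-th power of s_a s_b. The powers before the m-th are recognised as nontrivial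
    by their moving [a]. *)
Definition order_check : bool :=
  let K j := foldl dstep unit2 (altw (2 * j)) in
  (K m == unit2) && all (fun j => dact (K j) (1, 0) != (1, 0)) (iota 1 m.-1).

End RankTwo.

(** A1 x A1, A2, B2 and G2; the last two appear twice because either of a and b may be the longer
    root. *)
Definition rank2_types : seq (int * int * nat) :=
  [:: (0, 0, 2%N); (1, 1, 3%N); (1, 2, 4%N); (2, 1, 4%N); (1, 3, 6%N); (3, 1, 6%N)].

Lemma order_checked : all (fun t => order_check t.1.1 t.1.2 t.2) rank2_types.
Proof. by vm_compute. Qed.

Lemma YB_checked : all (fun t => YB_check t.1.1 t.1.2 t.2) rank2_types.
Proof. by vm_compute. Qed.

Lemma sum_mult (F : ending -> int) (U : seq ending) (L : seq (bool * ending)) :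
  uniq U -> {subset [seq p.2 | p <- L] <= U} ->
  \sum_(p <- L) (-1) ^+ p.1 * F p.2 = \sum_(e <- U) mult e L * F e.
Proof.
move=> uU; elim: L => [|p L IH] sub.
  by rewrite big_nil big1_seq // => e _; rewrite mul0r.
have pU : p.2 \in U by apply: sub; rewrite inE eqxx.
rewrite big_cons IH => [|e eL]; last by apply: sub; rewrite inE eL orbT.
rewrite (bigD1_seq p.2) // [in RHS](bigD1_seq p.2) //= eqxx addrA; congr (_ + _).
  by case: p.1; ring.
by apply: eq_bigr => e; rewrite eq_sym => /negPf->.
Qed.

Lemma same_sum (F : ending -> int) (L L' : seq (bool * ending)) : same L L' ->
  \sum_(p <- L) (-1) ^+ p.1 * F p.2 = \sum_(p <- L') (-1) ^+ p.1 * F p.2.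
Proof.
move=> /allP LL'; pose U := undup [seq p.2 | p <- L ++ L'].
rewrite !(@sum_mult F U) ?undup_uniq //; last 2 first.
- by move=> e; rewrite mem_undup map_cat mem_cat => ->; rewrite orbT.
- by move=> e; rewrite mem_undup map_cat mem_cat => ->.
apply: eq_big_seq => e; rewrite mem_undup => /mapP[p /LL' /eqP + ->].
by move=> ->.
Qed.

(** The roots are listed by angle, so a root between two others is a positive combination of them.
    Hence neither the positive values nor the nonpositive ones can surround a value of the other
    kind. *)
Lemma patterns_height (R : realType) (x y : R) t : t \in rank2_types ->
  [seq 0 < g.1%:~R * x + g.2%:~R * y | g <- groots t.1.1 t.1.2 t.2]
    \in patterns t.2.
Proof.
rewrite !inE => /or4P[/eqP->|/eqP->|/eqP->|/or3P[]/eqP->].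
- rewrite (_ : groots _ _ _ = [:: (1, 0); (0, 1)]) //= !(mul0r,mul1r).
  by do 2![case: ltrP => ?].
- rewrite (_ : groots _ _ _ = [:: (1, 0); (1, 1); (0, 1)]) //= !(mul0r,mul1r).
  do 3![case: ltrP => ?] => //; exfalso; lra.
- rewrite (_ : groots _ _ _ = [:: (1, 0); (1, 1); (1, 2); (0, 1)]) //= !(mul0r,mul1r).
  do 4![case: ltrP => ?] => //; exfalso; lra.
- rewrite (_ : groots _ _ _ = [:: (1, 0); (2, 1); (1, 1); (0, 1)]) //= !(mul0r,mul1r).
  do 4![case: ltrP => ?] => //; exfalso; lra.
- rewrite (_ : groots _ _ _ = [:: (1, 0); (1, 1); (2, 3); (1, 2); (1, 3); (0, 1)])
    //= !(mul0r,mul1r).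
  do 6![case: ltrP => ?] => //; exfalso; lra.
- rewrite (_ : groots _ _ _ = [:: (1, 0); (3, 1); (2, 1); (3, 2); (1, 1); (0, 1)])
    //= !(mul0r,mul1r).
  do 6![case: ltrP => ?] => //; exfalso; lra.
Qed.

(** * Heights and positivity of roots *)

Section Weyl.
Context {R : realType} {n : nat} {Phi : seq 'cV[R]_n}
  {delta omega : 'I_n -> 'cV[R]_n}.
Hypotheses (HPhi : root_system Phi) (Hbase : is_base Phi delta)
  (Hom : fund_weights delta omega).
Implicit Types (a b x : 'cV[R]_n) (v g : 'M[R]_n) (s : seq 'I_n).

(** Pairing with the sum of the fundamental coweights, each a rescaled fundamental weight; it takes
    the value 1 at every simple root, so its sign detects positivity. *)
Definition height x : R :=
  dot (\sum_j (2 / dot (delta j) (delta j)) *: omega j) x.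

Lemma heightD x y : height (x + y) = height x + height y.
Proof. exact: dotDr. Qed.

Lemma heightZ c x : height (c *: x) = c * height x.
Proof. exact: dotZr. Qed.

Lemma heightN x : height (- x) = - height x.
Proof. exact: dotNr. Qed.

Lemma root_neq0 {a} : a \in Phi -> a != 0.
Proof. by case: HPhi => _ Phi0 _ _ _; apply: contraTneq => ->. Qed.

Lemma root_refl {a b} : a \in Phi -> b \in Phi -> refl_mx a *m b \in Phi.
Proof. by case: HPhi => _ _ _ + _; apply. Qed.

Lemma rootN {a} : a \in Phi -> - a \in Phi.
Proof. by move=> aP; rewrite -(refl_self (root_neq0 aP)) root_refl. Qed.

Lemma delta_root i : delta i \in Phi.
Proof. by case: Hbase. Qed.

Lemma delta_neq0 i : delta i != 0.
Proof. exact: root_neq0 (delta_root i). Qed.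

Lemma delta_gt0 i : 0 < dot (delta i) (delta i).
Proof. exact: dotxx_gt0 (delta_neq0 i). Qed.

Lemma dot_omega_delta i j :
  dot (omega i) (delta j) = (i == j)%:R * (dot (delta j) (delta j) / 2).
Proof.
have /lt0r_neq0 d0 := delta_gt0 j.
rewrite -(Hom i j) dotZr; field; by rewrite d0.
Qed.

Lemma dot_omega_sum i (c : 'I_n -> int) :
  dot (omega i) (\sum_j (c j)%:~R *: delta j) =
  (c i)%:~R * (dot (delta i) (delta i) / 2).
Proof.
rewrite dot_sumr (bigD1 i) //= dotZr dot_omega_delta eqxx mul1r big1 ?addr0 //.
by move=> j ji; rewrite dotZr dot_omega_delta eq_sym (negPf ji) mul0r mulr0.
Qed.

Lemma height_delta i : height (delta i) = 1.
Proof.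
rewrite /height dot_suml (bigD1 i) //= dotZl dot_omega_delta eqxx mul1r.
rewrite big1 => [|j ji]; last by rewrite dotZl dot_omega_delta (negPf ji) mul0r mulr0.
by have /lt0r_neq0 d0 := delta_gt0 i; field.
Qed.

Lemma height_sum (c : 'I_n -> int) :
  height (\sum_j (c j)%:~R *: delta j) = (\sum_j c j)%:~R.
Proof.
rewrite /height dot_sumr rmorph_sum; apply: eq_bigr => j _.
by rewrite dotZr -/(height _) height_delta mulr1.
Qed.

Lemma sum_delta_neq0 (c : 'I_n -> int) :
  \sum_j (c j)%:~R *: delta j \in Phi -> exists j, c j != 0.
Proof.
move=> /root_neq0; apply: contra_neqP => /forallNP c0.
by apply: big1 => j _; have /negP := c0 j; rewrite negbK => /eqP->; rewrite scale0r.
Qed.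

Lemma sum_nneg_gt0 (c : 'I_n -> int) j :
  (forall i, 0 <= c i) -> c j != 0 -> 0 < \sum_i c i.
Proof.
move=> c0 cj; rewrite (bigD1 j) //= ltr_wpDr //; first exact: sumr_ge0.
by rewrite lt_def cj c0.
Qed.

Lemma root_height a : a \in Phi ->
  exists c : 'I_n -> int, a = \sum_i (c i)%:~R *: delta i /\
    (((forall i, 0 <= c i) /\ 0 < height a)
     \/ ((forall i, c i <= 0) /\ height a < 0)).
Proof.
move=> aP; case: Hbase => _ _ /(_ _ aP)[c [ac sg]]; exists c; split=> //.
move: aP; rewrite ac => /sum_delta_neq0[j cj].
rewrite height_sum ltr0z ltrz0; case: sg => c0; [left|right]; split=> //.
  exact: sum_nneg_gt0 cj.
rewrite -oppr_gt0 -sumrN; apply: (@sum_nneg_gt0 (fun i => - c i) j) => [i|].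
  by rewrite oppr_ge0.
by rewrite oppr_eq0.
Qed.

Lemma height_neq0 {a} : a \in Phi -> height a != 0.
Proof. by case/root_height => c [_ [] [_]]; [exact: lt0r_neq0|exact: ltr0_neq0]. Qed.

Lemma positiveP a : a \in Phi -> positive Phi delta a <-> 0 < height a.
Proof.
move=> aP; have [c [ac sg]] := root_height aP; split=> [[_ [c' [c0 ac']]]|a0].
  move: aP; rewrite ac' => /sum_delta_neq0[j cj].
  by rewrite height_sum ltr0z; apply: sum_nneg_gt0 cj.
split=> //; exists c; split=> //; case: sg => -[// _].
by move/lt_trans/(_ a0); rewrite ltxx.
Qed.

(* A positive root other than [delta i] has another simple root in its
   support, whose coefficient the reflection in [delta i] does not change. *)
Lemma simple_refl_pos i a : a \in Phi -> 0 < height a -> a != delta i ->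
  0 < height (refl_mx (delta i) *m a).
Proof.
move=> aP a0 ai; have sP := root_refl (delta_root i) aP.
have [c [ac [[c0 _]|[_]]]] := root_height aP; last first.
  by move/lt_trans/(_ a0); rewrite ltxx.
have [j ji cj] : exists2 j, j != i & c j != 0.
  apply/not_exists2P => h.
  have ai' : a = (c i)%:~R *: delta i.
    rewrite ac (bigD1 i) //= big1 ?addr0 // => j ji.
    by have [//|/negP] := h j; rewrite negbK => /eqP->; rewrite scale0r.
  case: HPhi => _ _ red _ _.
  move: aP; rewrite ai' => /(red _ _ (delta_root i))[] ci; rewrite ci in ai'.
    by case/eqP: ai; rewrite ai' scale1r.
  by move: a0; rewrite ai' heightZ height_delta mulr1 oppr_gt0 ltr10.
have [c' [sc [[_ //]|[c'0 _]]]] := root_height sP.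
have : dot (omega j) (refl_mx (delta i) *m a) = dot (omega j) a.
  by rewrite act_refl dotDr dotNr dotZr dot_omega_delta (negPf ji) mul0r mulr0 subr0.
rewrite sc {1}ac !dot_omega_sum => /mulIf.
have d0 : dot (delta j) (delta j) / 2 != 0.
  by rewrite lt0r_neq0 // divr_gt0 // delta_gt0.
move=> /(_ d0)/eqP; rewrite eqr_int => /eqP cc.
by move: cj; rewrite eq_le c0 -cc c'0.
Qed.

(** * Words in the simple reflections, strong exchange, length and covers *)

Definition word s : 'M[R]_n := \prod_(i <- s) refl_mx (delta i).
Definition simple_gen v := exists s, v = word s.

Lemma word_cons i s : word (i :: s) = refl_mx (delta i) *m word s.
Proof. by rewrite /word big_cons mulmxE. Qed.

Lemma word_cat s1 s2 : word (s1 ++ s2) = word s1 *m word s2.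
Proof. by rewrite /word big_cat mulmxE. Qed.

Lemma word_nil : word [::] = 1%:M.
Proof. by rewrite /word big_nil. Qed.

Lemma word_orth s : orth (word s).
Proof.
elim: s => [|i s IH]; rewrite ?word_nil ?word_cons; first exact: orth1.
by apply: orthM => //; apply: orth_refl; apply: delta_neq0.
Qed.

Lemma word_root s a : a \in Phi -> word s *m a \in Phi.
Proof.
move=> aP; elim: s => [|i s IH]; rewrite ?word_nil ?word_cons ?mul1mx //.
by rewrite -mulmxA root_refl // delta_root.
Qed.

Lemma simple_genM v g : simple_gen v -> simple_gen g -> simple_gen (v *m g).
Proof. by case=> s -> [s' ->]; exists (s ++ s'); rewrite word_cat. Qed.

(** A positive root that is not simple has positive product with some simple root, and reflecting in
    the latter lowers its height by at least 1. The induction runs on a natural bound for the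
    height. *)
Lemma refl_simple_gen a : a \in Phi -> simple_gen (refl_mx a).
Proof.
wlog a0 : a / 0 < height a => [hw aP|].
  have [/hw/(_ aP)//|] := ltP 0 (height a).
  rewrite le_eqVlt (negPf (height_neq0 aP)) /= => a0.
  by rewrite -reflN; apply: hw; rewrite ?rootN // heightN oppr_gt0.
have [N leN] : exists N : nat, height a <= N%:R.
  by exists (Num.truncn (height a)).+1; apply/ltW/truncnS_gt.
elim: N a a0 leN => [|N IH] a a0 leN aP; first by have := lt_le_trans a0 leN; rewrite ltxx.
have [c [ac [[c0 _]|[_]]]] := root_height aP; last first.
  by move/lt_trans/(_ a0); rewrite ltxx.
(* Otherwise expanding one factor of (a, a) in simple roots with nonnegative coefficients would give
   (a, a) <= 0. *)
have [i ai] : exists i, 0 < dot a (delta i).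
  apply: contrapT => /forallNP h; have := dotxx_gt0 (root_neq0 aP).
  rewrite {2}ac dot_sumr ltNge => /negP; apply; apply: sumr_le0 => i _.
  rewrite dotZr mulr_ge0_le0 ?ler0z // leNgt; exact/negP/h.
have [->|ai'] := eqVneq a (delta i).
  by exists [:: i]; rewrite word_cons word_nil mulmx1.
have di := delta_neq0 i.
have sP := root_refl (delta_root i) aP; have s0 := simple_refl_pos aP a0 ai'.
have [|t st] := IH _ s0 _ sP.
  rewrite act_refl heightD heightN heightZ height_delta mulr1.
  have : 1 <= dot a (coroot (delta i)).
    case: HPhi => _ _ _ _ /(_ _ _ (delta_root i) aP)/intrP[z zE].
    have : 0 < dot a (coroot (delta i)).
      by rewrite dotZr mulr_gt0 // divr_gt0 // delta_gt0.
    by rewrite zE ltr0z ler1z gtz0_ge1.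
  by move: leN; rewrite -natr1; lra.
have <- : refl_mx (delta i) *m refl_mx (refl_mx (delta i) *m a) *m refl_mx (delta i)
          = refl_mx a.
  by rewrite -mulmxA refl_act ?mulmxA ?reflK ?mul1mx //; apply: orth_refl.
by exists (i :: rcons t i); rewrite word_cons -cats1 word_cat st
  word_cons word_nil mulmx1 mulmxA.
Qed.

Lemma simple_gen_refl {v a} : simple_gen v -> a \in Phi -> simple_gen (v *m refl_mx a).
Proof. by move=> vW aP; apply: simple_genM => //; apply: refl_simple_gen. Qed.

Lemma simple_gen_root {v a} : simple_gen v -> a \in Phi -> v *m a \in Phi.
Proof. by case=> s -> /word_root. Qed.

(* Strong exchange: the deleted letter is the one at which the image of [a]
   under the suffixes of the word changes sign. *)
Lemma exchange s a : a \in Phi -> 0 < height a -> height (word s *m a) < 0 ->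
  exists2 s', (size s' < size s)%N & word s *m refl_mx a = word s'.
Proof.
move=> aP a0; elim: s => [|i s IH].
  by rewrite word_nil mul1mx => /(lt_trans a0); rewrite ltxx.
have [/IH[s' lt_s' s'E] _|] := ltP (height (word s *m a)) 0.
  by exists (i :: s'); rewrite // !word_cons -mulmxA s'E.
have sP := word_root s aP.
rewrite le_eqVlt eq_sym (negPf (height_neq0 sP)) /= word_cons -mulmxA => s0.
have [sa|ne] := eqVneq (word s *m a) (delta i); last first.
  by move/lt_trans/(_ (simple_refl_pos sP s0 ne)); rewrite ltxx.
exists s => //; rewrite -mulmxA -(refl_act a (word_orth s)) sa mulmxA.
by rewrite reflK ?mul1mx // delta_neq0.
Qed.

(** The value 0 is a default at matrices that are not words in the simple reflections. *)
Definition len v : nat :=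
  if pselect (exists l, length_is delta v l) is left H then projT1 (cid H) else 0%N.

Lemma lenP {v} : simple_gen v -> length_is delta v (len v).
Proof.
move=> [s sv]; rewrite /len; case: pselect => [H|[]]; first by case: cid.
have ex : exists k, `[< exists t, size t = k /\ v = word t >].
  by exists (size s); apply/asboolP; exists s.
case: (ex_minnP ex) => k /asboolP[t [tk vt]] kmin.
exists k; split; first by exists t.
by move=> t' vt'; apply: kmin; apply/asboolP; exists t'.
Qed.

Lemma length_is_inj v k l : length_is delta v k -> length_is delta v l -> k = l.
Proof.
by move=> [[s [<- vs]] mk] [[t [<- vt]] ml]; apply/eqP; rewrite eqn_leq mk ?ml.
Qed.

Lemma len_refl_lt v a : simple_gen v -> a \in Phi ->
  (0 < height a) != (0 < height (v *m a)) -> (len (v *m refl_mx a) < len v)%N.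
Proof.
move=> vW aP; have vaP := simple_gen_root vW aP.
wlog a0 : a aP vaP / 0 < height a => [hw|].
  have := height_neq0 aP; rewrite neq_lt => /orP[a0|/hw]; last exact.
  rewrite -(reflN a) => vpos; apply: hw; rewrite ?mulmxN ?rootN // !heightN.
    by rewrite oppr_gt0.
  move: vpos; rewrite !oppr_gt0 a0 ltNge (ltW a0).
  by have := height_neq0 vaP; case: (ltrgt0P (height (v *m a))).
rewrite a0 eq_sym eqb_id -leNgt le_eqVlt (negPf (height_neq0 vaP)) /=.
have [[t [tl vt]] _] := lenP vW; rewrite {1}vt => /(exchange aP a0)[s' lt_s' s'E].
have [_ /(_ s')] := lenP (simple_gen_refl vW aP).
by rewrite {1}vt s'E -tl => /(_ erefl)/leq_ltn_trans; apply.
Qed.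

(** Since v s_a sends a to - v a, the preceding lemma applies at v s_a and compares it with v s_a
    s_a = v. *)
Lemma len_refl_gt v a : simple_gen v -> a \in Phi ->
  (0 < height a) = (0 < height (v *m a)) -> (len v < len (v *m refl_mx a))%N.
Proof.
move=> vW aP e; have vaP := simple_gen_root vW aP.
have a0 := root_neq0 aP.
have := len_refl_lt (simple_gen_refl vW aP) aP.
rewrite -!mulmxA reflK // mulmx1 refl_self // mulmxN heightN oppr_gt0 e; apply.
by case: (ltrgt0P (height (v *m a))) => // /eqP; rewrite (negPf (height_neq0 vaP)).
Qed.

Definition cover v a : bool :=
  `[< exists l, length_is delta v l /\ length_is delta (v *m refl_mx a) l.+1 >].

Lemma coverE v a : simple_gen v -> a \in Phi ->
  cover v a = (len (v *m refl_mx a) == (len v).+1).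
Proof.
move=> vW aP; have lv := lenP vW; have ls := lenP (simple_gen_refl vW aP).
apply/asboolP/eqP => [[l [vl sl]]|e]; last by exists (len v); rewrite -e.
by rewrite (length_is_inj lv vl) (length_is_inj ls sl).
Qed.

Lemma cover_simple_gen v a : cover v a -> simple_gen v.
Proof. by case/asboolP => l [[[s [_ ->]] _] _]; exists s. Qed.

Lemma cover_height v a : cover v a -> a \in Phi ->
  (0 < height a) = (0 < height (v *m a)).
Proof.
move=> c aP; have vW := cover_simple_gen c; move: c; rewrite coverE // => /eqP e.
apply/eqP/negPn/negP => /(len_refl_lt vW aP); rewrite e.
by move/ltnW; rewrite ltnn.
Qed.

(** * The operators X^{ka} + B_a, their inverses and conjugation by X^lambda *)

Variables (h : R) (k : int).
Implicit Types (f : elt R n) (nu mu lam : 'cV[R]_n).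

Lemma BopE a f v nu : a \in Phi -> Bop Phi delta a f v nu =
  if cover v a then (-1) ^+ (~~ (0 < height a)) * f (v *m refl_mx a) nu else 0.
Proof.
move=> aP; have naP := rootN aP; rewrite /Bop.
have -> : `[< positive Phi delta a >] = (0 < height a).
  by have [p1 p2] := positiveP aP; apply/asboolP/idP.
have -> : `[< positive Phi delta (- a) >] = (height a < 0).
  by rewrite -oppr_gt0 -heightN; have [p1 p2] := positiveP naP; apply/asboolP/idP.
have := height_neq0 aP; rewrite neq_lt => /orP[a0|a0].
  rewrite a0 ltNge (ltW a0) /= expr1 mulN1r /Bpos reflN -/(cover v a).
  by case: ifP => //; rewrite oppr0.
by rewrite a0 /= mul1r.
Qed.

Lemma cover_ntwice v a : a \in Phi -> cover v a -> cover (v *m refl_mx a) a -> False.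
Proof.
move=> aP cv cs; have vW := cover_simple_gen cv; have sW := cover_simple_gen cs.
move: cv cs; rewrite !coverE // -mulmxA reflK ?mulmx1 ?(root_neq0 aP) //.
by move/eqP => -> /eqP; lia.
Qed.

Lemma act_refl_weight v a mu :
  v *m refl_mx a *m mu = v *m mu - dot mu (coroot a) *: (v *m a).
Proof. by rewrite -mulmxA act_refl mulmxBr -scalemxAr. Qed.

Definition R0 a : op R n := addop (Xop h (k%:~R *: a)) (Bop Phi delta a).

Lemma R0E a f v nu : a \in Phi -> R0 a f v nu =
  f v (nu - h^-1 *: (k%:~R *: (v *m a))) +
  if cover v a then (-1) ^+ (~~ (0 < height a)) * f (v *m refl_mx a) nu else 0.
Proof. by move=> aP; rewrite /R0 /addop BopE // /Xop /act -scalemxAr. Qed.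

(** As v s_a sends a to - v a, moving X^{ka} across B_a inverts it, so the cross terms cancel; the
    square of B_a vanishes by [cover_ntwice]. *)
Lemma R0NK a f : a \in Phi -> R0 (- a) (R0 a f) = f.
Proof.
move=> aP; have naP := rootN aP; have a0 := root_neq0 aP.
apply/funext => v; apply/funext => nu.
rewrite R0E // !R0E // reflN.
have -> : cover v (- a) = cover v a by rewrite /cover reflN.
rewrite !mulmxN -!mulmxA refl_self // reflK // mulmx1 !mulmxN !scalerN !opprK addrK.
have -> : (~~ (0 < height (- a))) = (0 < height a).
  by rewrite heightN oppr_gt0; have := height_neq0 aP; case: ltrgt0P.
case: ifP => cv; last by rewrite !addr0.
case: ifP => [cs|_]; first by case: (cover_ntwice aP cv cs).
by case: (0 < height a) => /=; rewrite ?expr0 ?expr1 ?mul1r ?mulN1r addr0 ?subrK ?addrK.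
Qed.

(** B_a relates v to v s_a, and v lam differs from v s_a lam by (lam, a^v) v a, which is the
    exponent in front of B_a. *)
Lemma Rmat_conj lam a f : a \in Phi ->
  Rmat Phi delta h lam k a f = Xop h lam (R0 a (Xop h (- lam) f)).
Proof.
move=> aP; apply/funext => v; apply/funext => nu.
rewrite /Rmat /R0 /addop {2 4}/Xop BopE // {2}/Xop BopE // /Xop /act.
congr (f v _ + _).
  by rewrite !mulmxN !scalerN opprK addrAC subrK.
case: ifP => // _; congr (_ * f _ _).
rewrite !mulmxN act_refl_weight -scalemxAr !scalerN opprK scalerBr addrA subrK.
by [].
Qed.

Lemma XopK lam : cancel (Xop h lam) (Xop h (- lam)).
Proof.
move=> f; apply/funext => v; apply/funext => nu.
by rewrite /Xop /act mulmxN scalerN opprK addrK.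
Qed.

Lemma opseq_conj lam (s : seq 'cV[R]_n) f : all (mem Phi) s ->
  opseq [seq Rmat Phi delta h lam k a | a <- s] f =
  Xop h lam (opseq [seq R0 a | a <- s] (Xop h (- lam) f)).
Proof.
rewrite /opseq; elim: s => [_|a s IH /= /andP[aP sP]] /=.
  by have := XopK (- lam) f; rewrite opprK.
by rewrite IH // Rmat_conj // XopK.
Qed.

(** * Realisation of the integer model in the plane of two roots *)

Section RankTwoPart.
Context {a b : 'cV[R]_n} {c d : int}.
Hypotheses (aP : a \in Phi) (bP : b \in Phi)
  (ba : dot b (coroot a) = - c%:~R) (ab : dot a (coroot b) = - d%:~R).

Definition ev (x : icoord) : 'cV[R]_n := x.1%:~R *: a + x.2%:~R *: b.

Definition wmx (K : rank2mx) : 'M[R]_n :=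
  let: (k11, k12, (k21, k22)) := K in
  1%:M + (k11%:~R *: (a *m (coroot a)^T) + k12%:~R *: (a *m (coroot b)^T)
          + (k21%:~R *: (b *m (coroot a)^T) + k22%:~R *: (b *m (coroot b)^T))).

Lemma wmx_unit2 : wmx unit2 = 1%:M.
Proof. by rewrite /wmx /= !scale0r !addr0. Qed.

Lemma ev10 : ev (1, 0) = a. Proof. by rewrite /ev scale1r scale0r addr0. Qed.
Lemma ev01 : ev (0, 1) = b. Proof. by rewrite /ev scale1r scale0r add0r. Qed.

Lemma evD (x y : icoord) : ev (x.1 + y.1, x.2 + y.2) = ev x + ev y.
Proof. by rewrite /ev /= !intrD !scalerDl addrACA. Qed.

Lemma evN (x : icoord) : ev (- x.1, - x.2) = - ev x.
Proof. by rewrite /ev /= !intrN !scaleNr opprD. Qed.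

Lemma wmx_ev K (x : icoord) : wmx K *m ev x = ev (dact c d K x).
Proof.
case: K => [[k11 k12] [k21 k22]]; case: x => x1 x2.
rewrite /wmx /dact mulmxDl mul1mx 3!mulmxDl -!scalemxAl !mul_rank1 /=.
rewrite /ev /= !dotDl !dotZl ba ab !dot_coroot ?root_neq0 //.
apply/matrixP => i j; rewrite !mxE !(intrD, intrM, intrB).
ring.
Qed.

Definition gen (s : bool) := if s then b else a.

Lemma gen_root (s : bool) : gen s \in Phi.
Proof. by case: s. Qed.

Lemma wmx_dstep K (s : bool) : wmx (dstep c d K s) = wmx K *m refl_mx (gen s).
Proof.
have Ka := wmx_ev K (1, 0); have Kb := wmx_ev K (0, 1).
rewrite ev10 in Ka; rewrite ev01 in Kb.
rewrite /refl_mx mulmxBr mulmx1 mulmxA.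
case: s; rewrite /gen ?Ka ?Kb; case: K {Ka Kb} => [[k11 k12] [k21 k22]];
  rewrite /wmx /dstep /dact /ev /= mulmxDl -!scalemxAl.
all: set A := a *m (coroot a)^T; set B := a *m (coroot b)^T;
  set C := b *m (coroot a)^T; set D := b *m (coroot b)^T.
all: apply/matrixP => i j; rewrite !mxE !(intrD, intrM, intrB) //=.
all: ring.
Qed.

Definition rword (s : seq bool) : 'M[R]_n := \prod_(t <- s) refl_mx (gen t).

Lemma rword_cons t (s : seq bool) : rword (t :: s) = refl_mx (gen t) *m rword s.
Proof. by rewrite /rword big_cons mulmxE. Qed.

Lemma rword_cat (s1 s2 : seq bool) : rword (s1 ++ s2) = rword s1 *m rword s2.
Proof. by rewrite /rword big_cat mulmxE. Qed.

Lemma wmx_word K (s : seq bool) : wmx (foldl (dstep c d) K s) = wmx K *m rword s.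
Proof.
elim: s K => [|t s IH] K /=; first by rewrite /rword big_nil mulmx1.
by rewrite IH wmx_dstep rword_cons mulmxA.
Qed.

Lemma rword_simple_gen (s : seq bool) : simple_gen (rword s).
Proof.
elim: s => [|t s IH]; first by exists [::]; rewrite word_nil /rword big_nil.
by rewrite rword_cons; apply: simple_genM => //; apply: refl_simple_gen (gen_root t).
Qed.

Lemma refl_rword (s : seq bool) t :
  refl_mx (rword s *m gen t) = rword (s ++ t :: rev s).
Proof.
elim: s => [|u s IH].
  by rewrite rword_cons /rword !big_nil mul1mx mulmx1.
have u0 := root_neq0 (gen_root u).
have -> : (u :: s) ++ t :: rev (u :: s) = u :: (s ++ t :: rev s) ++ [:: u].
  by rewrite rev_cons -cats1 /= -catA.
have -> : refl_mx (rword (u :: s) *m gen t) =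
    refl_mx (refl_mx (gen u) *m (rword s *m gen t)) by rewrite rword_cons mulmxA.
rewrite rword_cons rword_cat -IH [RHS]mulmxA -refl_act; last exact: orth_refl.
by rewrite -mulmxA rword_cons /rword big_nil mulmx1 reflK // mulmx1.
Qed.

Lemma alt_prodE j : alt_prod a b j = rword (altw j).
Proof.
rewrite /alt_prod -(big_mkord xpredT (fun i => if odd i then refl_mx b else refl_mx a)).
rewrite /rword /altw /mkseq big_map /index_iota subn0.
by apply: eq_bigr => i _; rewrite /gen; case: odd.
Qed.

Lemma gamma_rword j : gamma a b j = rword (altw j) *m gen (odd j).
Proof. by rewrite /gamma /act alt_prodE. Qed.

Lemma gamma_ev j : gamma a b j = ev (groot c d j).
Proof.
rewrite /groot -wmx_ev wmx_word wmx_unit2 mul1mx gamma_rword.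
by case: (odd j); rewrite ?ev01 ?ev10.
Qed.

Lemma refl_gamma j : refl_mx (gamma a b j) = rword (reflw j).
Proof. by rewrite gamma_rword refl_rword. Qed.

Lemma gamma_root j : gamma a b j \in Phi.
Proof.
rewrite gamma_rword; apply: simple_gen_root (gen_root _).
exact: rword_simple_gen.
Qed.

Lemma opseq_cons (A : op R n) (s : seq (op R n)) f : opseq (A :: s) f = A (opseq s f).
Proof. by []. Qed.

(** Elements are functions on all matrices. Outside the Weyl group there are no covers, so only
    commuting shifts of the exponent survive. *)
Lemma opseq_not_simple v js f nu : ~ simple_gen v ->
  opseq [seq R0 (gamma a b j) | j <- js] f v nu =
  f v (nu - \sum_(j <- js) h^-1 *: (k%:~R *: (v *m gamma a b j))).
Proof.
move=> vW; elim: js nu => [|j js IH] nu.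
  by rewrite big_nil subr0.
rewrite map_cons opseq_cons R0E ?gamma_root // IH big_cons opprD addrA.
by case: ifP => [/cover_simple_gen|_]; rewrite ?addr0.
Qed.

Lemma opseq_rev_not_simple v js f nu : ~ simple_gen v ->
  opseq [seq R0 (gamma a b j) | j <- js] f v nu =
  opseq [seq R0 (gamma a b j) | j <- rev js] f v nu.
Proof.
move=> vW; rewrite !opseq_not_simple //; congr (f v (nu - _)).
by apply: perm_big; rewrite perm_sym perm_rev.
Qed.

(** * Products of operators as sums over chains in a coset v <s_a, s_b> *)

Section Chamber.
Context {v : 'M[R]_n} {m : nat} {sg ta : seq bool}.
Hypotheses
  (Hta : forall j, (j < m)%N -> nth false ta j = (0 < height (gamma a b j)))
  (Hsg : forall x : icoord, isroot c d m x -> rpos c d m sg x = (0 < height (v *m ev x))).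

Definition translate (K : rank2mx) := v *m wmx K.

Lemma translate_word K (s : seq bool) :
  translate (foldl (dstep c d) K s) = translate K *m rword s.
Proof. by rewrite /translate wmx_word mulmxA. Qed.

(** The image of a root g at the point vK is v applied to the plane root Kg, so the single sign list
    [sg] at v governs every point of the coset. *)
Lemma translate_gamma K j : translate K *m gamma a b j = v *m ev (dact c d K (groot c d j)).
Proof. by rewrite gamma_ev /translate -mulmxA wmx_ev. Qed.

Lemma translate_refl K j :
  translate K *m refl_mx (gamma a b j) = translate (foldl (dstep c d) K (reflw j)).
Proof. by rewrite translate_word refl_gamma. Qed.

Lemma rpos_gamma K j : (j < m)%N -> isroot c d m (dact c d K (groot c d j)) ->
  (rpos c d m sg (dact c d K (groot c d j)) == nth false ta j) =
  ((0 < height (gamma a b j)) == (0 < height (translate K *m gamma a b j))).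
Proof. by move=> jm rt; rewrite Hsg // Hta // translate_gamma eq_sym. Qed.

Lemma paths_len js K : all (fun j => (j < m)%N) js -> inroots c d m js K ->
  simple_gen (translate K) -> forall p, p \in paths c d m sg ta js K ->
  (len (translate K) + p.2.1.2 <= len (translate p.2.1.1))%N.
Proof.
elim: js K => [|j js IH] K /=.
  by move=> _ _ _ p; rewrite inE => /eqP-> /=; rewrite addn0.
move=> /andP[jm jsm] /and3P[rt rK rK'] KW p; rewrite mem_cat => /orP[/mapP[q qp ->]|] /=.
  exact: IH qp.
rewrite rpos_gamma //; case: eqP => // e /mapP[q qp ->] /=.
have gP := gamma_root j; have := len_refl_gt KW gP e.
have := simple_gen_refl KW gP; rewrite translate_refl => KW'.
move=> lt; rewrite addnS -addSn; apply: leq_trans (IH _ jsm rK' KW' _ qp).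
by rewrite leq_add2r.
Qed.

(** The indicator says that the end point has exactly the length forced by a chain of covers. *)
Definition weigh f nu len0 (e : ending) : int :=
  (len (translate e.1.1) == len0 + e.1.2)%N%:R *
  f (translate e.1.1) (nu - h^-1 *: (k%:~R *: (v *m ev e.2))).

Lemma opseq_paths js K f nu : all (fun j => (j < m)%N) js -> inroots c d m js K ->
  simple_gen (translate K) ->
  opseq [seq R0 (gamma a b j) | j <- js] f (translate K) nu =
  \sum_(p <- paths c d m sg ta js K) (-1) ^+ p.1 * weigh f nu (len (translate K)) p.2.
Proof.
elim: js K nu => [|j js IH] K nu.
  rewrite /opseq /= big_seq1 /weigh /= addn0 eqxx /ev !scale0r addr0 mulmx0 !scaler0 subr0.
  by rewrite !mul1r.
move=> /= /andP[jm jsm] /and3P[rt rK rK'] KW; have gP := gamma_root j.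
have sW := simple_gen_refl KW gP.
rewrite R0E // IH // big_cat /= big_map; congr (_ + _).
  apply: eq_bigr => p _ /=; congr (_ * _); rewrite /weigh /=; congr (_ * f _ _).
  rewrite translate_gamma evD; move: (ev _) (ev _) => A B.
  by rewrite mulmxDr !scalerDr opprD addrA.
rewrite rpos_gamma //; case: eqP => [e|ne]; last first.
  by rewrite big_nil; case: ifP => // /cover_height/(_ gP)/ne.
have lt := len_refl_gt KW gP e.
rewrite coverE // big_map Hta // translate_refl in sW lt *.
case: eqP => [eK|neK].
  rewrite IH // mulr_sumr; apply: eq_bigr => p _ /=.
  by rewrite signr_addb mulrA [(-1) ^+ _ * _]mulrC /weigh /= eK addSnnS.
rewrite big_seq big1 // => p pp; rewrite /weigh /=.
have le := paths_len jsm rK' sW pp.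
rewrite gtn_eqF ?mul0r ?mulr0 //; apply: leq_trans le.
by rewrite addnS -!addSn leq_add2r ltn_neqAle lt andbT eq_sym; apply/eqP.
Qed.

End Chamber.

Lemma height_ev v (x : icoord) :
  height (v *m ev x) = x.1%:~R * height (v *m a) + x.2%:~R * height (v *m b).
Proof. by rewrite mulmxDr -!scalemxAr heightD !heightZ. Qed.

Lemma R0_YangBaxter m f : (c, d, m) \in rank2_types ->
  opseq [seq R0 (gamma a b j) | j <- iota 0 m] f =
  opseq [seq R0 (gamma a b j) | j <- rev (iota 0 m)] f.
Proof.
move=> typ; apply/funext => v; apply/funext => nu.
have [vW|vW] := pselect (simple_gen v); last exact: opseq_rev_not_simple.
(* At [w = 1] these are the signs of the roots g, at [w = v] those of the roots v g. *)
pose signs (w : 'M[R]_n) := [seq 0 < height (w *m ev g) | g : icoord <- groots c d m].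
have signs_pat w : signs w \in patterns m.
  rewrite /signs; under eq_map => x do rewrite height_ev.
  exact: patterns_height typ.
have Hta j : (j < m)%N -> nth false (signs 1%:M) j = (0 < height (gamma a b j)).
  move=> jm; rewrite /signs /groots -map_comp (nth_map 0%N) ?size_iota //=.
  by rewrite nth_iota // mul1mx gamma_ev.
have Hsg (x : icoord) : isroot c d m x ->
    rpos c d m (signs v) x = (0 < height (v *m ev x)).
  rewrite /isroot /rpos /signs; case: ifP => [xg _|_ /= xg].
    by rewrite (nth_map (0, 0)) ?index_mem // nth_index.
  rewrite (nth_map (0, 0)) ?index_mem // nth_index // evN mulmxN heightN oppr_gt0.
  have /height_neq0 : v *m ev x \in Phi.
    have [j _ gj] := mapP xg; rewrite -[v *m ev x]opprK -mulmxN -evN gj -gamma_ev.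
    by rewrite rootN // simple_gen_root // gamma_root.
  by case: ltrgt0P.
have /and3P[rt rtV /allP/(_ _ (signs_pat 1%:M))/allP/(_ _ (signs_pat v)) same_paths] :=
  allP YB_checked _ typ.
have lt_iota : all (fun j => (j < m)%N) (iota 0 m).
  by apply/allP => j; rewrite mem_iota.
have v1 : translate (v := v) unit2 = v by rewrite /translate wmx_unit2 mulmx1.
have v1W : simple_gen (translate (v := v) unit2) by rewrite v1.
have := opseq_paths Hta Hsg f nu lt_iota rt v1W; rewrite v1 => ->.
have ltV : all (fun j => (j < m)%N) (rev (iota 0 m)) by rewrite all_rev.
have := opseq_paths Hta Hsg f nu ltV rtV v1W; rewrite v1 => ->.
exact: same_sum.
Qed.

(** * The order of s_a s_b and the possible types of a pair of roots *)

Lemma rword_even j : rword (altw (2 * j)) = (refl_mx a * refl_mx b) ^+ j.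
Proof.
elim: j => [|j IH]; first by rewrite expr0 /rword big_nil.
rewrite exprSr -IH mulnS addnC addn2 /altw !mkseqS -!cats1 !rword_cat.
rewrite /= mul2n odd_double /= -!mulmxA; congr (_ *m _).
by rewrite !rword_cons /rword big_nil !mulmx1 mulmxE.
Qed.

Lemma order_rank2 m m' : (c, d, m) \in rank2_types -> (forall z : R, b != z *: a) ->
  order_is (refl_mx a * refl_mx b) m' -> m' = m.
Proof.
move=> typ ind [m'0 gm' m'min].
have wE j : (refl_mx a * refl_mx b) ^+ j = wmx (foldl (dstep c d) unit2 (altw (2 * j))).
  by rewrite -rword_even wmx_word wmx_unit2 mul1mx.
have /andP[/eqP Km /allP Kj] := allP order_checked _ typ.
have m0 : (0 < m)%N by move: typ; rewrite !inE => /or4P[| | |/or3P[]]; case/eqP=> _ _ ->.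
have a1 j : (0 < j < m)%N -> (refl_mx a * refl_mx b) ^+ j != 1.
  move=> jm; have /Kj : j \in iota 1 m.-1 by rewrite mem_iota add1n prednK.
  (* A trivial power fixes [a]; independence of a and b turns this into an equality of integer
     coordinates, which the finite check excludes. *)
  apply: contraNneq; rewrite wE => K1.
  have := wmx_ev (foldl (dstep c d) unit2 (altw (2 * j))) (1, 0).
  rewrite K1 mul1mx ev10; case: (dact _ _ _ _) => y1 y2 E.
  have y20 : y2 = 0.
    apply: contraTeq (ind ((1 - y1%:~R) / y2%:~R)) => y20; rewrite negbK.
    have y20' : y2%:~R != 0 :> R by rewrite intr_eq0.
    apply/eqP/(scalerI y20'); rewrite scalerA mulrC divfK // scalerBl scale1r.
    by rewrite [in X in _ = X - _]E /ev /= addrC addKr.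
  move: E; rewrite y20 -{1}ev10 /ev /= !scale0r !addr0 => /eqP.
  rewrite -subr_eq0 -scalerBl scaler_eq0 (negPf (root_neq0 aP)) orbF.
  by rewrite subr_eq0 eqr_int => /eqP<-.
have [lt|gt|//] := ltngtP m' m.
  by have := a1 m'; rewrite m'0 lt gm' eqxx => /(_ isT).
have := m'min m; rewrite m0 gt wE Km wmx_unit2.
by move=> /(_ isT)/eqP[].
Qed.

End RankTwoPart.

(** Strict Cauchy-Schwarz bounds the product of the two Cartan integers below 4; they are
    nonpositive and vanish together, which leaves the six listed cases. *)
Lemma root_pair_type a b : a \in Phi -> b \in Phi -> dot a b <= 0 -> b != - a ->
  (forall z : R, b != z *: a) /\
  exists t, [/\ t \in rank2_types, dot b (coroot a) = - t.1.1%:~R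
              & dot a (coroot b) = - t.1.2%:~R].
Proof.
move=> aP bP ab0 ba; have aa := dotxx_gt0 (root_neq0 aP).
have bb := dotxx_gt0 (root_neq0 bP).
have ind z : b != z *: a.
  apply: contraNneq ba => bz; case: HPhi => _ _ red _ _.
  move: bP; rewrite bz => /(red _ _ aP)[] z1; rewrite z1 ?scaleN1r //.
  by move: ab0; rewrite bz z1 scale1r leNgt aa.
split=> //; case: (HPhi) => _ _ _ _ cart.
have /intrP[p pE] := cart _ _ aP bP; have /intrP[q qE] := cart _ _ bP aP.
have CS : dot a b ^+ 2 < dot a a * dot b b.
  (* The component of b orthogonal to a, nonzero by independence. *)
  pose u := b - (dot a b / dot a a) *: a.
  have : 0 < dot u u by apply: dotxx_gt0; rewrite subr_eq0.
  have -> : dot u u = (dot a a * dot b b - dot a b ^+ 2) / dot a a.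
    rewrite /u !(dotDl, dotDr, dotNl, dotNr, dotZl, dotZr) (dotC b a); field.
    exact: lt0r_neq0.
  by rewrite pmulr_lgt0 ?invr_gt0 // subr_gt0.
have pE' : p%:~R = 2 * dot a b / dot a a :> R.
  by rewrite -pE dotZr (dotC b a) mulrAC.
have qE' : q%:~R = 2 * dot a b / dot b b :> R by rewrite -qE dotZr mulrAC.
have p0 : p <= 0.
  by rewrite -(ler_int R) pE' pmulr_lle0 ?invr_gt0 // pmulr_rle0.
have q0 : q <= 0.
  by rewrite -(ler_int R) qE' pmulr_lle0 ?invr_gt0 // pmulr_rle0.
have pq : p * q < 4.
  rewrite -(ltr_int R) intrM pE' qE' mulf_div ltr_pdivrMr ?mulr_gt0 //.
  have -> : (4%:Z)%:~R = 2 * 2 :> R by rewrite -natrM.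
  by rewrite mulrACA -(expr2 (dot a b)) ltr_pM2l ?mulr_gt0.
have pq0 : (p == 0) = (q == 0).
  rewrite -!(intr_eq0 R) pE' qE' !mulf_eq0 !invr_eq0.
  by rewrite (negPf (lt0r_neq0 aa)) (negPf (lt0r_neq0 bb)).
have [[c cE] [d dE]] : (exists c : nat, p = - c%:Z) /\ (exists d : nat, q = - d%:Z).
  by split; [exists `|p|%N | exists `|q|%N]; rewrite abszE ler0_norm // opprK.
suff [m typ] : exists m, (c%:Z, d%:Z, m) \in rank2_types.
  by exists (c%:Z, d%:Z, m); rewrite pE qE cE dE !intrN.
have cd : (c * d < 4)%N by move: pq; rewrite cE dE; lia.
have cd0 : (c == 0)%N = (d == 0)%N by move: pq0; rewrite cE dE; lia.
case: c d cd cd0 {cE dE} => [|[|[|[|c]]]] [|[|[|[|d]]]] //= cd _.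
all: try by exists 2%N.
all: try by exists 3%N.
all: try by exists 4%N.
all: try by exists 6%N.
all: exfalso; lia.
Qed.

Lemma RmatNK lam a f : a \in Phi ->
  Rmat Phi delta h lam k (- a) (Rmat Phi delta h lam k a f) = f.
Proof.
move=> aP; rewrite !Rmat_conj ?rootN // XopK R0NK //.
by have := XopK (- lam) f; rewrite opprK.
Qed.

Lemma Rmat_YangBaxter lam a b m f : a \in Phi -> b \in Phi -> dot a b <= 0 ->
  order_is (refl_mx a * refl_mx b) m ->
  opseq [seq Rmat Phi delta h lam k (gamma a b j) | j <- iota 0 m] f =
  opseq (rev [seq Rmat Phi delta h lam k (gamma a b j) | j <- iota 0 m]) f.
Proof.
move=> aP bP ab0 om; have [ba|ba] := eqVneq b (- a).
  (* For [b = - a] the two reflections coincide, their product is 1, and both sides consist of a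
     single factor. *)
  have {om} -> // : m = 1%N.
  case: om => m0 _ /(_ 1%N) mmin; apply/eqP; rewrite eqn_leq m0 andbT leqNgt.
  apply/negP => /mmin; rewrite expr1 ba reflN -mulmxE reflK ?(root_neq0 aP) //.
  by case/eqP.
have [ind [[[c d] m'] [typ bac abd]]] := root_pair_type aP bP ab0 ba.
rewrite {om}(order_rank2 aP bP bac abd typ ind om).
have inPhi js : all (mem Phi) [seq gamma a b j | j <- js].
  by apply/allP => _ /mapP[j _ ->]; apply: gamma_root.
rewrite -map_rev [in LHS]map_comp [in RHS]map_comp !opseq_conj // -!map_comp.
by congr (Xop h lam); apply: R0_YangBaxter typ.
Qed.

End Weyl.

(** * The conjugation formula and the R-matrix property *)

Unset Implicit Arguments.

Theorem theorem10p1 (R : realType) (n : nat) (Phi : seq 'cV[R]_n)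
  (delta omega : 'I_n -> 'cV[R]_n) (thv lam : 'cV[R]_n) (k : int) :
  root_system Phi -> irreducible_rs Phi -> is_base Phi delta ->
  fund_weights delta omega -> highest_coroot Phi delta thv ->
  weight Phi lam ->
  let h := coxeter omega thv in
  let Rop := Rmat Phi delta h lam k in
  (forall a, a \in Phi -> forall f, in_Kt Phi h f ->
     Rop a f = Xop h lam (addop (Xop h (k%:~R *: a)) (Bop Phi delta a)
                                (Xop h (- lam) f))) /\
  is_R_matrix Phi h Rop.
Proof.
move=> HPhi _ Hbase Hom _ _ h Rop.
split=> [a aP f _|]; first exact: (Rmat_conj HPhi Hbase Hom).
split=> [a aP f _|a b aP bP ab0 m om f _].
  split; first exact: (RmatNK HPhi Hbase Hom).
  by rewrite -[X in Rop X (Rop (- a) f)]opprK; apply: (RmatNK HPhi Hbase Hom); apply: rootN.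
exact: (Rmat_YangBaxter HPhi Hbase Hom).
Qed.
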